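(* Let $R$ be a cubiculated region, let $\psi:S\to R^\ast$ be a discrete Seifert surface with $\partial S\neq\emptyset$, and let $\mathcal{G}^\ast$ be the subgraph of $\mathcal{G}(R^\ast)$ formed by the vertices and edges of $R^\ast$ contained in $\psi[S]$. Let $t_0,t_1$ be stable tilings of $S$ with $\mathrm{Flux}_S(t_0)=\mathrm{Flux}_S(t_1)$. Then $t_0$ and $t_1$ are connected by a sequence of flips (on $S$).
   Context: A cubiculated region $R$ is a finite cubical complex embedded as a polyhedron in some $\mathbb{R}^N$ which is a connected oriented topological $3$-manifold with (possibly empty) boundary, such that every interior edge lies in exactly four cubes, cubes are colored black and white with face-adjacent cubes of opposite colors, and there are as many black as white cubes. The dual complex $R^\ast\subset R$ has vertices the centers of cubes, edges joining centers of face-adjacent cubes, squares dual to interior edges and cubes dual to interior vertices; $\mathcal{G}(R^\ast)$ is its $1$-skeleton (bipartite). A discrete Seifert surface is a connected embedded discrete surface $(S,\psi)$: $S$ an oriented topological surface with boundary, $\psi:S\to R^\ast$ injective continuous with image a union of vertices, edges and squares of $R^\ast$, whose boundary $\psi|_{\partial S}$ is the system of nontrivial cycles of the difference of two tilings of $R$. A tiling of $S$ is a perfect matching of $\mathcal{G}^\ast$; its edges are oriented from white to black vertex, so for tilings $t,\tilde t$ of $S$, $t-\tilde t$ is a $1$-cycle on $S$. Fix a base tiling $t_b$ of $S$ and set $\mathrm{Flux}_S(t)=[t-t_b]\in H_1(S;\mathbb{Z})$. A tiling $t$ of $S$ is stable if every edge of $\mathcal{G}^\ast$ belongs to some tiling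 $\tilde t$ of $S$ with $\mathrm{Flux}_S(\tilde t)=\mathrm{Flux}_S(t)$. A flip on $S$ replaces two opposite edges of a square of $\psi[S]$, both in the tiling, by the other two edges of that square. *)

(* Defs.v *)
From HB Require Import structures.
From mathcomp Require Import all_boot all_order all_algebra.
From mathcomp Require Import all_classical all_reals all_analysis.
From Stdlib Require Export Relation_Operators.
Set Implicit Arguments.
Unset Strict Implicit.
Unset Printing Implicit Defensive.
Import Order.TTheory GRing.Theory Num.Theory.
Import numFieldNormedType.Exports.
Local Open Scope classical_set_scope.
Local Open Scope ring_scope.

(** * Topological manifolds with boundary *)

(* Some relatively open neighbourhood of x in A is homeomorphic to a relatively
   open subset of B. *)
Definition locally_homeomorphic_at (T U : topologicalType) (A : set T)
    (B : set U) (x : T) : Prop :=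
  exists (O : set T) (W : set U) (f : T -> U) (g : U -> T),
    [/\ open O /\ O x, open W, {within A `&` O, continuous f},
        {within B `&` W, continuous g} &
        f @` (A `&` O) = B `&` W /\ forall y, (A `&` O) y -> g (f y) = y].

Definition half_space (K : realType) (n : nat) : set 'rV[K]_n.+1 :=
  [set x | 0 <= x ord0 ord0].

(* A is locally modelled on the half-space of dimension n.+1; the separation
   and countability axioms are stated separately, as they are automatic for
   subsets of K^N. *)
Definition locally_half_space (K : realType) (n : nat) (T : topologicalType)
    (A : set T) : Prop :=
  forall x, A x -> locally_homeomorphic_at A (@half_space K n) x.

Definition manifold_boundary (K : realType) (n : nat) (T : topologicalType)
    (A : set T) : set T :=
  [set x | A x /\ ~ locally_homeomorphic_at A [set: 'rV[K]_n.+1] x].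

(** * Cubical complexes *)

Definition unit_cube (K : realType) (k : nat) : set 'rV[K]_k :=
  [set x | forall i, 0 <= x ord0 i <= 1].

Definition cube_center (K : realType) (k : nat) : 'rV[K]_k := const_mx (1 / 2).

(* A continuous map on a cube that is everywhere given by one of finitely many
   affine maps is piecewise linear. *)
Definition piecewise_linear_on (K : realType) (k N : nat) (A : set 'rV[K]_k)
    (f : 'rV[K]_k -> 'rV[K]_N) : Prop :=
  {within A, continuous f} /\
  exists L : seq ('M[K]_(k, N) * 'rV[K]_N),
    forall x, A x -> exists2 l, l \in L & f x = x *m l.1 + l.2.

(* The isometric parametrizations of the m-dimensional faces of the k-cube by
   the m-cube: coordinate j of x, possibly reversed, becomes coordinate s j, and
   the other coordinates are constantly 0 or 1. *)
Definition face_map (K : realType) (m k : nat) (h : 'rV[K]_m -> 'rV[K]_k) :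
    Prop :=
  exists (s : 'I_m -> 'I_k) (r : 'I_m -> bool) (b : 'I_k -> bool),
    injective s /\ forall x,
      (forall j, h x ord0 (s j) = if r j then 1 - x ord0 j else x ord0 j) /\
      (forall i, (forall j, s j <> i) -> h x ord0 i = (b i)%:R).

Definition is_face_via (K : realType) (N : nat) (cell : nat -> finType)
    (chi : forall k, cell k -> 'rV[K]_k -> 'rV[K]_N) (m k : nat)
    (s : cell m) (c : cell k) (h : 'rV[K]_m -> 'rV[K]_k) : Prop :=
  face_map h /\ forall x, unit_cube x -> chi m s x = chi k c (h x).

Definition carrier_via (K : realType) (N : nat) (cell : nat -> finType)
    (chi : forall k, cell k -> 'rV[K]_k -> 'rV[K]_N) (k : nat) (s : cell k) :
    set 'rV[K]_N :=
  chi k s @` @unit_cube K k.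

(* A finite cubical complex embedded as a polyhedron in K^N: cell k indexes the
   k-dimensional cells and chi s is the characteristic map of the cell s. *)
Record cubical_complex (K : realType) (N : nat) := CubicalComplex {
  cell : nat -> finType;
  chi : forall k, cell k -> 'rV[K]_k -> 'rV[K]_N;
  cell_bounded : exists d, forall k, (d < k)%N -> #|cell k| = 0%N;
  chi_pl : forall k (s : cell k),
    piecewise_linear_on (@unit_cube K k) (chi s);
  chi_inj : forall k (s : cell k) x y,
    unit_cube x -> unit_cube y -> chi s x = chi s y -> x = y;
  carrier_inj : forall k (s t : cell k),
    carrier_via chi s = carrier_via chi t -> s = t;
  cell_face : forall m k (c : cell k) (h : 'rV[K]_m -> 'rV[K]_k),
    face_map h -> exists s : cell m, (exists h', is_face_via chi s c h') /\
      carrier_via chi s = chi c @` (h @` @unit_cube K m);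
  cell_inter : forall k l (s : cell k) (t : cell l),
    carrier_via chi s `&` carrier_via chi t !=set0 ->
    exists m (u : cell m),
      [/\ carrier_via chi s `&` carrier_via chi t = carrier_via chi u,
          exists h, is_face_via chi u s h & exists h, is_face_via chi u t h]
}.
Arguments chi {K N} X {k} s x : rename.

Definition glued (K : realType) (N : nat) (X : cubical_complex K N) (m k : nat)
    (s : cell X m) (c : cell X k) (h : 'rV[K]_m -> 'rV[K]_k) : Prop :=
  is_face_via (@chi K N X) s c h.

Definition is_face (K : realType) (N : nat) (X : cubical_complex K N)
    (m k : nat) (s : cell X m) (c : cell X k) : Prop :=
  exists h, glued s c h.

Definition carrier (K : realType) (N : nat) (X : cubical_complex K N)
    (k : nat) (s : cell X k) : set 'rV[K]_N :=
  carrier_via (@chi K N X) s.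

Definition polyhedron (K : realType) (N : nat) (X : cubical_complex K N) :
    set 'rV[K]_N :=
  [set y | exists k (s : cell X k), carrier s y].

Definition cube (K : realType) (N : nat) (X : cubical_complex K N) : finType :=
  cell X 3.

Definition interior_cell (K : realType) (N : nat) (X : cubical_complex K N)
    (k : nat) (s : cell X k) : Prop :=
  ~ (carrier s `<=` @manifold_boundary K 2 _ (polyhedron X)).

Definition face_adjacent (K : realType) (N : nat) (X : cubical_complex K N)
    (c d : cube X) : Prop :=
  c <> d /\ exists f : cell X 2, is_face f c /\ is_face f d.

(* A coherent choice of orientation of all 3-cells, o c being true when c
   carries the orientation opposite to the standard one of [0, 1]^3.  When c and
   d share the face f, the affine map x |-> x *m M + v is the coordinate change
   that continues the coordinates of c across f into those of d: it agrees with
   the gluing along f, and sends the center of the cube to the mirror image of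
   the center in the face. *)
Definition coherent_cube_orientation (K : realType) (N : nat)
    (X : cubical_complex K N) (o : cube X -> bool) : Prop :=
  forall (c d : cube X) (f : cell X 2) (hc hd : 'rV[K]_2 -> 'rV[K]_3)
    (M : 'M[K]_3) (v : 'rV[K]_3),
    c <> d -> glued f c hc -> glued f d hd ->
    (forall x, hc x *m M + v = hd x) ->
    cube_center K 3 *m M + v = 2%:R *: hd (cube_center K 2) - cube_center K 3 ->
    \det M = (-1) ^+ (o c (+) o d).

(** * Cubiculated regions and their dual complexes *)

Record cubiculated_region (K : realType) (N : nat) := CubiculatedRegion {
  region_complex :> cubical_complex K N;
  region_manifold : locally_half_space K 2 (polyhedron region_complex);
  region_connected : connected (polyhedron region_complex);
  region_orientation : cube region_complex -> bool;
  region_oriented : coherent_cube_orientation region_orientation;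
  region_four_cubes : forall e : cell region_complex 1, interior_cell e ->
    #|[pred c : cube region_complex | `[< is_face e c >]]| = 4%N;
  black : cube region_complex -> bool;
  black_adjacent : forall c d : cube region_complex,
    face_adjacent c d -> black c = ~~ black d;
  black_balanced : #|[pred c | black c]| = #|[pred c | ~~ black c]|
}.

(* The dual cell of s is assembled from one box in each cube c containing s: in
   the coordinates of c, the box having the center of c and the center of s as
   opposite corners.  The dual cell of a cube is its center; those of interior
   faces, edges and vertices are the edges, squares and cubes of the dual
   complex. *)
Definition dual_cell (K : realType) (N : nat) (X : cubical_complex K N)
    (k : nat) (s : cell X k) : set 'rV[K]_N :=
  [set y | exists (c : cube X) (h : 'rV[K]_k -> 'rV[K]_3),
    glued s c h /\
    (chi X c @` [set x : 'rV[K]_3 | forall i,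
       Num.min (1 / 2) (h (cube_center K k) ord0 i) <= x ord0 i
         <= Num.max (1 / 2) (h (cube_center K k) ord0 i)]) y].

Definition dual_complex (K : realType) (N : nat) (X : cubical_complex K N) :
    set 'rV[K]_N :=
  [set y | exists k (s : cell X k), interior_cell s /\ dual_cell s y].

Definition dual_edge (K : realType) (N : nat) (X : cubical_complex K N)
    (c d : cube X) : set 'rV[K]_N :=
  [set y | exists f : cell X 2, [/\ is_face f c, is_face f d & dual_cell f y]].

(* The square dual to e, as a closed walk through the centers of the cubes
   around e. *)
Definition square_walk (K : realType) (N : nat) (X : cubical_complex K N)
    (e : cell X 1) (w : seq (cube X)) : Prop :=
  [/\ uniq w, forall c, c \in w <-> is_face e c &
      forall c, c \in w -> face_adjacent c (next w c)].

Definition traverses (T : eqType) (w : seq T) (c d : T) : bool :=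
  (c \in w) && (next w c == d).

(* Edges of the graph of the dual complex are ordered pairs (white, black); a
   tiling is a set of such pairs. *)
Definition edge_type (K : realType) (N : nat) (X : cubical_complex K N) :
    finType :=
  (cube X * cube X)%type.

Definition region_edge (K : realType) (N : nat) (X : cubiculated_region K N)
    (p : edge_type X) : Prop :=
  [/\ ~~ black p.1, black p.2 & face_adjacent p.1 p.2].

Definition mk_edge (K : realType) (N : nat) (X : cubiculated_region K N)
    (c d : cube X) : edge_type X :=
  if black c then (d, c) else (c, d).

(* The coefficient of the edge p in the 1-cycle of the closed walk w, a step
   from a black to a white cube being counted negatively. *)
Definition walk_chain (K : realType) (N : nat) (X : cubiculated_region K N)
    (w : seq (cube X)) (p : edge_type X) : int :=
  \sum_(c <- w) (if black c then -1 else 1) * (mk_edge c (next w c) == p)%:R.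

Definition perfect_matching (T : finType) (V : T -> Prop) (E : T * T -> Prop)
    (t : {set T * T}) : Prop :=
  (forall p, p \in t -> E p) /\
  forall c, V c -> exists! p, p \in t /\ (p.1 = c \/ p.2 = c).

Definition region_tiling (K : realType) (N : nat) (X : cubiculated_region K N)
    (t : {set edge_type X}) : Prop :=
  perfect_matching (fun _ => True) (@region_edge K N X) t.

(** * Embedded discrete surfaces *)

(* ds_walk orients S: it chooses for each square of S a direction of traversal
   of its boundary, and distinct squares of S traverse a common edge in opposite
   directions. *)
Record embedded_discrete_surface (K : realType) (N : nat)
    (X : cubiculated_region K N) (S : topologicalType) := EmbeddedDiscreteSurface {
  ds_hausdorff : hausdorff_space S;
  ds_second_countable : @second_countable S;
  ds_compact : compact [set: S];
  ds_surface : locally_half_space K 1 [set: S];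
  ds_map : S -> 'rV[K]_N;
  ds_continuous : continuous ds_map;
  ds_injective : injective ds_map;
  ds_dual : range ds_map `<=` dual_complex X;
  ds_cells : exists (A0 : {set cell X 3}) (A1 : {set cell X 2})
      (A2 : {set cell X 1}),
    [/\ forall f, f \in A1 -> interior_cell f,
        forall e, e \in A2 -> interior_cell e &
        range ds_map = \bigcup_(c in [set` A0]) dual_cell c `|`
          \bigcup_(f in [set` A1]) dual_cell f `|`
          \bigcup_(e in [set` A2]) dual_cell e];
  ds_square : cell X 1 -> Prop :=
    fun e => interior_cell e /\ dual_cell e `<=` range ds_map;
  ds_walk : cell X 1 -> seq (cube X);
  ds_walkP : forall e, ds_square e -> square_walk e (ds_walk e);
  ds_coherent : forall e e' c d, ds_square e -> ds_square e' -> e <> e' ->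
    ~ (traverses (ds_walk e) c d /\ traverses (ds_walk e') c d)
}.

Definition surface_boundary (K : realType) (S : topologicalType) : set S :=
  @manifold_boundary K 1 S [set: S].

(* The cellular boundary of the integral 2-chain u, the squares of S being
   oriented by S and the edges from white to black. *)
Definition chain_boundary (K : realType) (N : nat) (X : cubiculated_region K N)
    (S : topologicalType) (D : embedded_discrete_surface X S)
    (u : cell X 1 -> int) (p : edge_type X) : int :=
  \sum_(e : cell X 1 | `[< ds_square D e >]) u e * walk_chain (ds_walk D e) p.

Definition tiling_diff (T : finType) (t t' : {set T}) (p : T) : int :=
  (p \in t)%:R - (p \in t')%:R.

(* The boundary of S is the union of the nontrivial cycles of t - t', that is,
   of the edges belonging to exactly one of t and t'; with the orientation
   induced from S it is the 1-cycle t - t'. *)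
Definition is_discrete_Seifert_surface (K : realType) (N : nat)
    (X : cubiculated_region K N) (S : topologicalType)
    (D : embedded_discrete_surface X S) : Prop :=
  connected [set: S] /\
  exists t t' : {set edge_type X},
    [/\ region_tiling t, region_tiling t',
        ds_map D @` @surface_boundary K S =
          [set y | exists p, tiling_diff t t' p <> 0 /\ dual_edge p.1 p.2 y] &
        forall p, chain_boundary D (fun _ => 1) p = tiling_diff t t' p].

(** * Tilings of a surface, flux and flips *)

Definition surface_vertex (K : realType) (N : nat) (X : cubiculated_region K N)
    (S : topologicalType) (D : embedded_discrete_surface X S) (c : cube X) :
    Prop :=
  dual_cell (c : cell X 3) `<=` range (ds_map D).

Definition surface_edge (K : realType) (N : nat) (X : cubiculated_region K N)
    (S : topologicalType) (D : embedded_discrete_surface X S)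
    (p : edge_type X) : Prop :=
  region_edge p /\ dual_edge p.1 p.2 `<=` range (ds_map D).

Definition surface_tiling (K : realType) (N : nat) (X : cubiculated_region K N)
    (S : topologicalType) (D : embedded_discrete_surface X S)
    (t : {set edge_type X}) : Prop :=
  perfect_matching (surface_vertex D) (surface_edge D) t.

(* The class of t - tb in H_1(S; Z), as a coset of the group of cellular
   1-boundaries of S. *)
Definition Flux (K : realType) (N : nat) (X : cubiculated_region K N)
    (S : topologicalType) (D : embedded_discrete_surface X S)
    (tb t : {set edge_type X}) : set (edge_type X -> int) :=
  [set z | exists u : cell X 1 -> int,
    forall p, z p = tiling_diff t tb p + chain_boundary D u p].

Definition stable (K : realType) (N : nat) (X : cubiculated_region K N)
    (S : topologicalType) (D : embedded_discrete_surface X S)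
    (tb t : {set edge_type X}) : Prop :=
  forall p, surface_edge D p -> exists t' : {set edge_type X},
    [/\ surface_tiling D t', Flux D tb t' = Flux D tb t & p \in t'].

Definition flip (K : realType) (N : nat) (X : cubiculated_region K N)
    (S : topologicalType) (D : embedded_discrete_surface X S)
    (t t' : {set edge_type X}) : Prop :=
  exists (e : cell X 1) (c0 c1 c2 c3 : cube X),
    [/\ ds_square D e, square_walk e [:: c0; c1; c2; c3],
        mk_edge c0 c1 \in t, mk_edge c2 c3 \in t &
        t' = ((t :\: [set mk_edge c0 c1; mk_edge c2 c3])
              :|: [set mk_edge c1 c2; mk_edge c3 c0])%SET].

Definition flip_connected (K : realType) (N : nat)
    (X : cubiculated_region K N) (S : topologicalType)
    (D : embedded_discrete_surface X S) (t t' : {set edge_type X}) : Prop :=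
  clos_refl_trans {set edge_type X} (flip D) t t'.

(* Main.v *)
(** Write t0 - t1 = du for an integral 2-chain u, and let T be the set of all
    tilings with the flux of t0.  For each t in T write t0 - t = d(u_t), and set
    n = #|T|, W = \sum_(t in T) t and H = \sum_(t in T) u_t, so that
    n t0 - W = dH: up to the factor n, H is the height function of t0 relative to
    the average of T.  Stability makes 0 < W < n on every edge of a square, hence
    H jumps across every such edge, in a direction that tells whether the edge
    lies in t0.  A square that maximizes H among those with u > 0 is a local
    maximum of H, so it can be flipped, which lowers u by one there.  If u <= 0,
    exchange the roles of t0 and t1; iterate until u = 0. *)

Require Import Defs.
From mathcomp Require Import all_boot all_order all_algebra.
From mathcomp Require Import all_classical all_reals all_analysis.
From mathcomp Require Import ring lra zify.
Set Implicit Arguments.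
Unset Strict Implicit.
Unset Printing Implicit Defensive.
Import Order.TTheory GRing.Theory Num.Theory.
Local Open Scope classical_set_scope.
Local Open Scope ring_scope.

(** * Face maps between cubes *)

Lemma fun_image_dec (T : finType) (U : eqType) (s : T -> U) (i : U) :
  (exists j, s j = i) \/ (forall j, s j <> i).
Proof.
case: (pickP (fun j => s j == i)) => [j /eqP sj|ns]; first by left; exists j.
by right=> j /eqP; rewrite ns.
Qed.

Lemma unit_cube_center (K : realType) (k : nat) : unit_cube (cube_center K k).
Proof. by move=> i; rewrite mxE; lra. Qed.

Lemma face_map_unit_cube (K : realType) (m k : nat)
    (h : 'rV[K]_m -> 'rV[K]_k) x :
  face_map h -> unit_cube x -> unit_cube (h x).
Proof.
move=> [s [r [b [_ hE]]]] Ux i; have [hs hb] := hE x.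
case: (fun_image_dec s i) => [[j <-]|ni].
  by rewrite hs; have := Ux j; case: (r j) => //; lra.
by rewrite (hb _ ni); case: (b i); rewrite ?lexx ?ler01.
Qed.

Lemma face_map_comp (K : realType) (m k l : nat)
    (g : 'rV[K]_m -> 'rV[K]_k) (h : 'rV[K]_k -> 'rV[K]_l) :
  face_map g -> face_map h -> face_map (h \o g).
Proof.
move=> [s [r [b [s_inj gE]]]] [s' [r' [b' [s'_inj hE]]]].
(* Reflections compose by exclusive or. A coordinate missed by [s' \o s] is either missed by [s'],
   with constant value from [b'], or is [s' j] with [j] missed by [s]; then its value is [b j],
   reflected when [r' j] holds. *)
exists (s' \o s), (fun j => r j (+) r' (s j)),
  (fun i => if [pick j | s' j == i] is Some j then b j (+) r' j else b' i).
split=> [|x]; first exact: inj_comp.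
have [gs gb] := gE x; have [hs hb] := hE (g x); split=> [j|i ni] /=.
  by rewrite hs gs; case: (r j); case: (r' (s j)) => /=; ring.
case: pickP => [j /eqP sj|ns]; last by apply: hb => j /eqP; rewrite ns.
rewrite -sj hs gb; last by move=> j' sj'; apply: (ni j'); rewrite /= sj'.
by case: (b j); case: (r' j) => /=; ring.
Qed.

Lemma face_map_leq (K : realType) (m k : nat) (h : 'rV[K]_m -> 'rV[K]_k) :
  face_map h -> (m <= k)%N.
Proof.
by move=> [s [_ [_ [s_inj _]]]]; have := leq_card s s_inj; rewrite !card_ord.
Qed.

(** An injection of ['I_k] into itself is bijective, so no coordinate is constant and [h] can be
    inverted coordinatewise. *)
Lemma face_map_onto (K : realType) (k : nat) (h : 'rV[K]_k -> 'rV[K]_k) y :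
  face_map h -> unit_cube y -> exists2 x, unit_cube x & h x = y.
Proof.
move=> [s [r [b [s_inj hE]]]] Uy.
exists (\row_j if r j then 1 - y ord0 (s j) else y ord0 (s j)).
  by move=> j; rewrite mxE; have := Uy (s j); case: (r j) => //; lra.
apply/rowP => i; have [t _ st] := injF_bij s_inj.
rewrite -(st i) (hE _).1 mxE.
by case: (r _) => //; ring.
Qed.

(** A coordinate missed by [s] would be constant on the image, yet a map onto the cube takes both
    values 0 and 1 there. So [s] is surjective and [k <= m]. *)
Lemma face_map_onto_dim (K : realType) (m k : nat)
    (h : 'rV[K]_m -> 'rV[K]_k) :
  face_map h -> (forall y, unit_cube y -> exists2 x, unit_cube x & h x = y) ->
  m = k.
Proof.
move=> fh onto; apply/eqP; rewrite eqn_leq (face_map_leq fh) /=.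
case: fh => [s [r [b [s_inj hE]]]].
have surj i : exists j, s j = i.
  case: (fun_image_dec s i) => // ni.
  have [|x _ hx] := onto (const_mx 0); first by move=> ?; rewrite mxE lexx ler01.
  have [|x' _ hx'] := onto (const_mx 1); first by move=> ?; rewrite mxE lexx ler01.
  have := (hE x).2 _ ni; have := (hE x').2 _ ni.
  by rewrite hx hx' !mxE => <- /eqP; rewrite eq_sym oner_eq0.
have [t st] := choice surj.
by have := leq_card t (can_inj st); rewrite !card_ord.
Qed.

(** * Faces, carriers and intersections of cells *)

Lemma glued_comp (K : realType) (N : nat) (X : cubical_complex K N)
    (m k l : nat) (s : cell X m) (r : cell X k) (c : cell X l) g h :
  glued s r g -> glued r c h -> glued s c (h \o g).
Proof.
move=> [fg gE] [fh hE]; split; first exact: face_map_comp.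
by move=> x Ux; rewrite gE // hE //; exact: face_map_unit_cube.
Qed.

Lemma is_face_carrier_sub (K : realType) (N : nat) (X : cubical_complex K N)
    (m k : nat) (s : cell X m) (c : cell X k) :
  is_face s c -> carrier s `<=` carrier c.
Proof.
move=> [h [fh hE]] _ [x Ux <-]; rewrite hE //.
by exists (h x) => //; exact: face_map_unit_cube.
Qed.

Lemma is_face_same_dim (K : realType) (N : nat) (X : cubical_complex K N)
    (k : nat) (s c : cell X k) :
  is_face s c -> s = c.
Proof.
move=> sc; apply: carrier_inj; apply/seteqP; split.
  exact: is_face_carrier_sub sc.
move: sc => [h [fh hE]] _ [y Uy <-].
by have [x Ux <-] := face_map_onto fh Uy; exists x => //; exact: hE.
Qed.

(** Injectivity of [chi X c] turns equality of the carriers into surjectivity of the face map. *)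
Lemma is_face_carrier_eq_dim (K : realType) (N : nat)
    (X : cubical_complex K N) (m k : nat) (s : cell X m) (c : cell X k) :
  is_face s c -> carrier s = carrier c -> m = k.
Proof.
move=> [h [fh hE]] sc; apply: (face_map_onto_dim fh) => y Uy.
have : carrier s (chi X c y) by rewrite sc; exists y.
move=> [x Ux]; rewrite hE // => /chi_inj xy.
by exists x => //; apply: xy => //; exact: face_map_unit_cube.
Qed.

(** The cell carried by the intersection is a face of both cells. Here it has the carrier of [s],
    hence the dimension of [s], hence it is [s]. *)
Lemma carrier_sub_is_face (K : realType) (N : nat) (X : cubical_complex K N)
    (m k : nat) (s : cell X m) (c : cell X k) :
  carrier s `<=` carrier c -> is_face s c.
Proof.
move=> sc; have sI : carrier s `&` carrier c = carrier s by exact/setIidPl.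
have [|n [u [uE us uc]]] := @cell_inter _ _ X _ _ s c.
  rewrite -/(carrier s) -/(carrier c) sI.
  by exists (chi X s (cube_center K m)); exists (cube_center K m) => //;
    exact: unit_cube_center.
have {}uE : carrier u = carrier s by rewrite -sI.
have nm := is_face_carrier_eq_dim us uE; case: m / nm s sc sI us uE => s _ _ us _.
by rewrite -(is_face_same_dim us).
Qed.

(** The intersection is a cell [u] containing [f] and contained in [c], so of dimension 2 or 3.
    Dimension 3 would force [c = u = d]; in dimension 2 it must be [f]. *)
Lemma face_adjacent_carrier (K : realType) (N : nat) (X : cubical_complex K N)
    (c d : cube X) (f : cell X 2) :
  c <> d -> is_face f c -> is_face f d ->
  carrier f = carrier c `&` carrier d.
Proof.
move=> cd fc fd.
have fcd : carrier f `<=` carrier c `&` carrier d.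
  by move=> y fy; split; [exact: is_face_carrier_sub fc _ fy|
                          exact: is_face_carrier_sub fd _ fy].
have [|m [u [uE uc ud]]] := @cell_inter _ _ X _ _ c d.
  exists (chi X f (cube_center K 2)); apply: fcd.
  by exists (cube_center K 2) => //; exact: unit_cube_center.
rewrite -/(carrier c) -/(carrier d) -/(carrier u) in uE.
have fu : is_face f u by apply: carrier_sub_is_face; rewrite -uE.
have m2 : (2 <= m)%N by case: fu => h [/face_map_leq].
have m3 : (m <= 3)%N by case: uc => h [/face_map_leq].
rewrite uE; case: m u uc ud fu m2 m3 {uE} => [|[|[|[|m]]]] // u uc ud fu _ _.
  by rewrite (is_face_same_dim fu).
by case: cd; rewrite -(is_face_same_dim uc) -(is_face_same_dim ud).
Qed.

(** * Dual cells, and the vertices and edges of the squares of the surface *)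

(** Duality reverses inclusion already box by box in a common cube: along coordinates that vary on
    [r] the box of [r] is flat at [1 / 2], and in the others the centers of [s] and [r] agree. *)
Lemma dual_cell_sub (K : realType) (N : nat) (X : cubical_complex K N)
    (m k : nat) (s : cell X m) (r : cell X k) :
  is_face s r -> dual_cell r `<=` dual_cell s.
Proof.
move=> [g sr] _ [c [h [rc [x xbox <-]]]].
exists c, (h \o g); split; first exact: glued_comp sr rc.
exists x => // i; move: (xbox i) => /=.
case: rc => -[s' [r' [b' [_ hE]]]] _.
case: (fun_image_dec s' i) => [[j <-]|ni].
  rewrite (hE _).1 mxE; have -> : (if r' j then 1 - 1 / 2 else 1 / 2) = 1 / 2 :> K.
    by case: (r' j) => //; lra.
  rewrite minxx maxxx => /andP[le1 le2].
  have -> : x ord0 (s' j) = 1 / 2 by apply/eqP; rewrite eq_le le1 le2.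
  by rewrite ge_min le_max lexx.
by rewrite !(hE _).2.
Qed.

Lemma square_vertex (K : realType) (N : nat) (R : cubiculated_region K N)
    (S : topologicalType) (psi : embedded_discrete_surface R S)
    (e : cell R 1) (c : cube R) :
  ds_square psi e -> is_face e c -> surface_vertex psi c.
Proof. by move=> [_ sub_e] ec; apply: subset_trans sub_e; exact: dual_cell_sub. Qed.

(** Any common face [f] of [c] and [d] is carried by their intersection, so it contains [e]; its
    dual edge then lies in the square dual to [e]. *)
Lemma square_edge (K : realType) (N : nat) (R : cubiculated_region K N)
    (S : topologicalType) (psi : embedded_discrete_surface R S)
    (e : cell R 1) (c d : cube R) :
  ds_square psi e -> is_face e c -> is_face e d -> region_edge (c, d) ->
  surface_edge psi (c, d).
Proof.
move=> [_ sub_e] ec ed cd; split=> // y [f [fc fd fy]]; apply: (sub_e).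
have [_ _ [/= neq_cd _]] := cd.
apply: dual_cell_sub fy; apply: carrier_sub_is_face.
rewrite (face_adjacent_carrier neq_cd fc fd) => z ez.
by split; [exact: is_face_carrier_sub ec _ ez|
           exact: is_face_carrier_sub ed _ ez].
Qed.

Lemma face_adjacent_sym (K : realType) (N : nat) (X : cubical_complex K N)
    (c d : cube X) :
  face_adjacent c d -> face_adjacent d c.
Proof. by move=> [cd [f [fc fd]]]; split; [exact: nesym|exists f]. Qed.

(** * The boundary walk of a square *)

(** Edges crossed from white to black, and with [down_edges] those crossed from black to white. For
    a square they are its two pairs of opposite edges, which a flip exchanges. *)
Definition up_edges (K : realType) (N : nat) (R : cubiculated_region K N)
    (w : seq (cube R)) : {set edge_type R} :=
  [set p : edge_type R | ~~ black p.1 && traverses w p.1 p.2]%SET.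

Definition down_edges (K : realType) (N : nat) (R : cubiculated_region K N)
    (w : seq (cube R)) : {set edge_type R} :=
  [set p : edge_type R | ~~ black p.1 && traverses w p.2 p.1]%SET.

Lemma square_walk_black (K : realType) (N : nat) (R : cubiculated_region K N)
    (e : cell R 1) (w : seq (cube R)) (c : cube R) :
  square_walk e w -> c \in w -> black c = ~~ black (next w c).
Proof. by move=> [_ _ adj] /adj; exact: black_adjacent. Qed.

(** Spreads a number attached to one vertex over the walk, so that it can be compared with
    [walk_chain] term by term. *)
Lemma sum_uniq_delta (T : eqType) (w : seq T) (x : T) (v : int) :
  uniq w -> (x \notin w -> v = 0) -> \sum_(c <- w) (c == x)%:R * v = v.
Proof.
move=> uw v0; have [xw|/v0->] := boolP (x \in w); last first.
  by rewrite big1 // => i _; rewrite mulr0.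
rewrite (bigD1_seq x) //= eqxx mul1r big1 ?addr0 // => i /negPf->.
by rewrite mul0r.
Qed.

Lemma walk_chainE (K : realType) (N : nat) (R : cubiculated_region K N)
    (e : cell R 1) (w : seq (cube R)) (p : edge_type R) :
  square_walk e w ->
  walk_chain w p = (p \in up_edges w)%:R - (p \in down_edges w)%:R.
Proof.
move=> sw; have [uw _ _] := sw.
(* Each indicator is placed at the vertex where the step starts: the white end of an up edge, the
   black end of a down edge. *)
rewrite -{1}(@sum_uniq_delta _ w p.1 (p \in up_edges w)%:R) //; last first.
  by rewrite inE /traverses => /negPf->; rewrite andbF.
rewrite -[X in _ - X](@sum_uniq_delta _ w p.2) //; last first.
  by rewrite inE /traverses => /negPf->; rewrite andbF.
rewrite /walk_chain -sumrB; apply: eq_big_seq => c cw.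
have cb := square_walk_black sw cw.
case: p => x y; rewrite !inE /traverses /mk_edge /=.
case bc: (black c) cb => cb; rewrite xpair_eqE.
  have -> : (c == x)%:R * (~~ black x && ((x \in w) && (next w x == y)))%:R = 0 :> int.
    by have [<-|] := eqVneq c x; rewrite ?bc ?mul0r ?mulr0.
  have [<-|] := eqVneq c y; last by rewrite andbF mul0r mulr0 subrr.
  rewrite cw /=; have [<-|] := eqVneq (next w c) x; last by rewrite !andbF; lia.
  by rewrite -cb; lia.
have -> : (c == y)%:R * (~~ black x && ((y \in w) && (next w y == x)))%:R = 0 :> int.
  have [<-|] := eqVneq c y; last by rewrite mul0r.
  by have [<-|] := eqVneq (next w c) x; rewrite ?andbF ?mulr0 // -cb /= mulr0.
have [<-|] := eqVneq c x; last by rewrite mul0r mulr0 subrr.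
by rewrite cw bc /=; lia.
Qed.

Lemma square_walk_rot (K : realType) (N : nat) (X : cubical_complex K N)
    (e : cell X 1) (w : seq (cube X)) (n : nat) :
  square_walk e w -> square_walk e (rot n w).
Proof.
move=> [uw we adj]; split=> [|c|c]; rewrite ?rot_uniq ?mem_rot //.
by rewrite next_rot //; exact: adj.
Qed.

Lemma traverses_rot (T : eqType) (w : seq T) (n : nat) (c d : T) :
  uniq w -> traverses (rot n w) c d = traverses w c d.
Proof. by move=> uw; rewrite /traverses mem_rot next_rot. Qed.

(** An interior edge lies in four cubes, whose colors alternate along the walk. Rotating the walk to
    start at a white cube gives all squares the same normal form. *)
Lemma square_corners (K : realType) (N : nat) (R : cubiculated_region K N)
    (S : topologicalType) (psi : embedded_discrete_surface R S)
    (e : cell R 1) :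
  ds_square psi e ->
  exists c0 c1 c2 c3 : cube R,
    [/\ square_walk e [:: c0; c1; c2; c3],
        [&& ~~ black c0, black c1, ~~ black c2 & black c3],
        up_edges (ds_walk psi e) = [set (c0, c1); (c2, c3)]%SET &
        down_edges (ds_walk psi e) = [set (c2, c1); (c0, c3)]%SET].
Proof.
move=> sq_e; have sw := ds_walkP sq_e; set w := ds_walk psi e in sw *.
have [uw we _] := sw.
have size_w : size w = 4%N.
  transitivity #|w|; first exact/esym/card_uniqP.
  rewrite -(region_four_cubes sq_e.1); apply: eq_card => c.
  by rewrite !inE; apply/idP/asboolP => /we.
have [n [c0 [c1 [c2 [c3 [w'E c0w]]]]]] : exists n c0 c1 c2 c3,
    rot n w = [:: c0; c1; c2; c3] /\ ~~ black c0.
  case: w size_w sw uw we => [|a [|b [|c [|d [|]]]]] // _ sw uw we.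
  case ba: (black a).
    exists 1%N, b, c, d, a; split=> //.
    by have := square_walk_black sw (mem_head _ _); rewrite /= eqxx ba => <-.
  by exists 0%N, a, b, c, d; rewrite ba.
have sw' := square_walk_rot n sw; rewrite w'E in sw'.
have blk := square_walk_black sw'.
have [uw' _ _] := sw'.
have upE p : (p \in up_edges w) = (p \in up_edges [:: c0; c1; c2; c3]).
  by rewrite !inE -w'E traverses_rot.
have downE p : (p \in down_edges w) = (p \in down_edges [:: c0; c1; c2; c3]).
  by rewrite !inE -w'E traverses_rot.
have [n01 [n02 [n03 [n12 [n13 n23]]]]] : c0 != c1 /\ c0 != c2 /\ c0 != c3 /\
    c1 != c2 /\ c1 != c3 /\ c2 != c3.
  move: uw'; rewrite /= !inE !negb_or.
  by move=> /andP[/and3P[-> -> ->] /andP[/andP[-> ->] /andP[-> _]]].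
have nx0 : next [:: c0; c1; c2; c3] c0 = c1 by rewrite /= eqxx.
have nx1 : next [:: c0; c1; c2; c3] c1 = c2.
  by rewrite /= ![c1 == _]eq_sym (negPf n01) eqxx.
have nx2 : next [:: c0; c1; c2; c3] c2 = c3.
  by rewrite /= ![c2 == _]eq_sym (negPf n02) (negPf n12) eqxx.
have nx3 : next [:: c0; c1; c2; c3] c3 = c0.
  by rewrite /= ![c3 == _]eq_sym (negPf n03) (negPf n13) (negPf n23) eqxx.
have b1 : black c1 by have := blk c0; rewrite nx0 mem_head (negPf c0w) => /(_ isT)/esym/negbFE.
have b2 : ~~ black c2 by have := blk c1; rewrite nx1 !inE eqxx orbT b1 => <-.
have b3 : black c3.
  by have := blk c2; rewrite nx2 !inE eqxx !orbT (negPf b2) => /(_ isT)/esym/negbFE.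
exists c0, c1, c2, c3; split=> //; first by rewrite c0w b1 b2 b3.
  apply/setP => -[x y]; rewrite upE !inE /traverses !xpair_eqE.
  rewrite ![(x, y).1]/= ![(x, y).2]/= !inE.
  have [->|x0] := eqVneq x c0.
    by rewrite nx0 c0w (negPf n02) orbF [y == c1]eq_sym.
  have [->|x1] := eqVneq x c1; first by rewrite b1 (negPf n12).
  have [->|x2] := eqVneq x c2; first by rewrite nx2 b2 [y == c3]eq_sym.
  by have [->|x3] := eqVneq x c3; rewrite ?b3 ?andbF.
apply/setP => -[x y]; rewrite downE !inE /traverses !xpair_eqE.
rewrite ![(x, y).1]/= ![(x, y).2]/= !inE.
have [->|y0] := eqVneq y c0.
  rewrite nx0 (negPf n01) (negPf n03) !andbF; apply/negP => /andP[xw /eqP c1x].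
  by move: xw; rewrite -c1x b1.
have [->|y1] := eqVneq y c1.
  rewrite nx1 (negPf n13) andbF orbF andbT [c2 == x]eq_sym.
  by have [->|] := eqVneq x c2; rewrite ?b2 // !andbF.
have [->|y2] := eqVneq y c2.
  rewrite nx2 (negPf n23) !andbF; apply/negP => /andP[xw /eqP c3x].
  by move: xw; rewrite -c3x b3.
have [->|y3] := eqVneq y c3; last by rewrite !andbF.
rewrite nx3 andbF andbT [c0 == x]eq_sym.
by have [->|] := eqVneq x c0; rewrite ?c0w // !andbF.
Qed.

Lemma square_edges_surface (K : realType) (N : nat)
    (R : cubiculated_region K N) (S : topologicalType)
    (psi : embedded_discrete_surface R S) (e : cell R 1) (p : edge_type R) :
  ds_square psi e ->
  p \in (up_edges (ds_walk psi e) :|: down_edges (ds_walk psi e))%SET ->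
  surface_edge psi p /\ surface_vertex psi p.1.
Proof.
move=> sq_e; have sw := ds_walkP sq_e; have [uw we adj] := sw.
have key c : c \in ds_walk psi e ->
    [/\ is_face e c, is_face e (next (ds_walk psi e) c) &
        face_adjacent c (next (ds_walk psi e) c)].
  by move=> cw; split; [exact/we|apply/we; rewrite mem_next|exact: adj].
case: p => x y; rewrite !inE /traverses /=.
move=> /orP[] /and3P[xw cw /eqP nxt]; have [fc fd cd] := key _ cw;
  have := square_walk_black sw cw; rewrite nxt in fd cd * => bw.
- split; last exact: square_vertex sq_e fc.
  by apply: square_edge sq_e fc fd _; split=> //=; rewrite -[black y]negbK -bw.
- split; last exact: square_vertex sq_e fd.
  apply: square_edge sq_e fd fc _; split=> //=; first by rewrite bw.
  exact: face_adjacent_sym.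
Qed.

(** * Boundaries of 2-chains on an edge, and local maxima of the height *)

Lemma chain_boundaryE (K : realType) (N : nat) (R : cubiculated_region K N)
    (S : topologicalType) (psi : embedded_discrete_surface R S)
    (u : cell R 1 -> int) (p : edge_type R) :
  chain_boundary psi u p =
  \sum_(e | `[< ds_square psi e >]) u e * (p \in up_edges (ds_walk psi e))%:R -
  \sum_(e | `[< ds_square psi e >]) u e * (p \in down_edges (ds_walk psi e))%:R.
Proof.
rewrite /chain_boundary -sumrB; apply: eq_bigr => e /asboolP sq_e.
by rewrite (walk_chainE p (ds_walkP sq_e)) mulrBr.
Qed.

Lemma sum_unique_indicator (Q : finType) (P B : pred Q) (u : Q -> int) (e : Q) :
  P e -> B e -> (forall x, P x -> B x -> x = e) ->
  \sum_(x | P x) u x * (B x)%:R = u e.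
Proof.
move=> Pe Be uniq_e; rewrite (bigD1 e) //= Be mulr1 big1 ?addr0 // => x.
move=> /andP[Px xe]; case Bx: (B x); last by rewrite mulr0.
by rewrite (uniq_e x Px Bx) eqxx in xe.
Qed.

(** The orientation of the surface: distinct squares never traverse an edge in the same
    direction. *)
Lemma up_edges_unique (K : realType) (N : nat) (R : cubiculated_region K N)
    (S : topologicalType) (psi : embedded_discrete_surface R S)
    (e e' : cell R 1) (p : edge_type R) :
  ds_square psi e -> ds_square psi e' ->
  p \in up_edges (ds_walk psi e) -> p \in up_edges (ds_walk psi e') -> e = e'.
Proof.
move=> sq_e sq_e'; rewrite !inE => /andP[_ pe] /andP[_ pe'].
by apply: contrapT => ee'; exact: ds_coherent sq_e sq_e' ee' (conj pe pe').
Qed.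

Lemma down_edges_unique (K : realType) (N : nat) (R : cubiculated_region K N)
    (S : topologicalType) (psi : embedded_discrete_surface R S)
    (e e' : cell R 1) (p : edge_type R) :
  ds_square psi e -> ds_square psi e' ->
  p \in down_edges (ds_walk psi e) -> p \in down_edges (ds_walk psi e') ->
  e = e'.
Proof.
move=> sq_e sq_e'; rewrite !inE => /andP[_ pe] /andP[_ pe'].
by apply: contrapT => ee'; exact: ds_coherent sq_e sq_e' ee' (conj pe pe').
Qed.

(** At most one square has [p] as an up edge and at most one as a down edge. So the boundary of [u]
    at [p] is the jump of [u] across [p], with value 0 where no second square exists. The square
    [e'] does not depend on [u], so it serves [u] and [H] at once. *)
Lemma chain_boundary_up (K : realType) (N : nat) (R : cubiculated_region K N)
    (S : topologicalType) (psi : embedded_discrete_surface R S)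
    (e : cell R 1) (p : edge_type R) :
  ds_square psi e -> p \in up_edges (ds_walk psi e) ->
  (forall u, chain_boundary psi u p = u e) \/
  exists2 e', ds_square psi e' & forall u, chain_boundary psi u p = u e - u e'.
Proof.
move=> sq_e pe.
have up_sum (u : cell R 1 -> int) : \sum_(x | `[< ds_square psi x >])
    u x * (p \in up_edges (ds_walk psi x))%:R = u e.
  apply: (@sum_unique_indicator _ (fun x => `[< ds_square psi x >])
    (fun x => p \in up_edges (ds_walk psi x))).
  - exact/asboolP.
  - exact: pe.
  - by move=> x /asboolP sq_x px; apply: up_edges_unique px pe.
case: (pickP [pred x | `[< ds_square psi x >] & p \in down_edges (ds_walk psi x)]).
  move=> e' /= /andP[/asboolP sq_e' pe']; right; exists e' => // u.
  rewrite chain_boundaryE up_sum; congr (_ - _).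
  apply: (@sum_unique_indicator _ (fun x => `[< ds_square psi x >])
    (fun x => p \in down_edges (ds_walk psi x))).
  - exact/asboolP.
  - exact: pe'.
  - by move=> x /asboolP sq_x px; apply: down_edges_unique px pe'.
move=> none; left=> u; rewrite chain_boundaryE up_sum big1 ?subr0 // => x sq_x.
by have := none x; rewrite /= sq_x /= => ->; rewrite mulr0.
Qed.

Lemma chain_boundary_down (K : realType) (N : nat) (R : cubiculated_region K N)
    (S : topologicalType) (psi : embedded_discrete_surface R S)
    (e : cell R 1) (p : edge_type R) :
  ds_square psi e -> p \in down_edges (ds_walk psi e) ->
  (forall u, chain_boundary psi u p = - u e) \/
  exists2 e', ds_square psi e' & forall u, chain_boundary psi u p = u e' - u e.
Proof.
move=> sq_e pe.
have down_sum (u : cell R 1 -> int) : \sum_(x | `[< ds_square psi x >])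
    u x * (p \in down_edges (ds_walk psi x))%:R = u e.
  apply: (@sum_unique_indicator _ (fun x => `[< ds_square psi x >])
    (fun x => p \in down_edges (ds_walk psi x))).
  - exact/asboolP.
  - exact: pe.
  - by move=> x /asboolP sq_x px; apply: down_edges_unique px pe.
case: (pickP [pred x | `[< ds_square psi x >] & p \in up_edges (ds_walk psi x)]).
  move=> e' /= /andP[/asboolP sq_e' pe']; right; exists e' => // u.
  rewrite chain_boundaryE down_sum; congr (_ - _).
  apply: (@sum_unique_indicator _ (fun x => `[< ds_square psi x >])
    (fun x => p \in up_edges (ds_walk psi x))).
  - exact/asboolP.
  - exact: pe'.
  - by move=> x /asboolP sq_x px; apply: up_edges_unique px pe'.
move=> none; left=> u; rewrite chain_boundaryE down_sum big1 ?sub0r // => x sq_x.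
by have := none x; rewrite /= sq_x /= => ->; rewrite mulr0.
Qed.

Lemma chain_boundary_subZ (K : realType) (N : nat) (R : cubiculated_region K N)
    (S : topologicalType) (psi : embedded_discrete_surface R S)
    (u v : cell R 1 -> int) (k : int) (p : edge_type R) :
  chain_boundary psi (fun e => u e - k * v e) p =
  chain_boundary psi u p - k * chain_boundary psi v p.
Proof.
rewrite /chain_boundary mulr_sumr -sumrB; apply: eq_bigr => e _.
by rewrite mulrBl mulrA.
Qed.

Lemma chain_boundary_sum (K : realType) (N : nat) (R : cubiculated_region K N)
    (S : topologicalType) (psi : embedded_discrete_surface R S) (I : finType)
    (A : {set I}) (u : I -> cell R 1 -> int) (p : edge_type R) :
  chain_boundary psi (fun e => \sum_(i in A) u i e) p =
  \sum_(i in A) chain_boundary psi (u i) p.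
Proof.
rewrite /chain_boundary exchange_big /=; apply: eq_bigr => e _.
by rewrite mulr_suml.
Qed.

Lemma chain_boundary_delta (K : realType) (N : nat)
    (R : cubiculated_region K N) (S : topologicalType)
    (psi : embedded_discrete_surface R S) (e : cell R 1) (p : edge_type R) :
  ds_square psi e ->
  chain_boundary psi (fun x => (x == e)%:R) p =
  (p \in up_edges (ds_walk psi e))%:R - (p \in down_edges (ds_walk psi e))%:R.
Proof.
move=> sq_e; rewrite /chain_boundary (bigD1 e) /=; last exact/asboolP.
rewrite eqxx mul1r (walk_chainE p (ds_walkP sq_e)) big1 ?addr0 //.
by move=> x /andP[_ /negPf->]; rewrite mul0r.
Qed.

(* A square maximizing H over the squares where u is positive is a local maximum
   of H on all of S: the edges where this could fail separate it from squares
   where u is at least as large. *)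
Lemma exists_descending_square (K : realType) (N : nat)
    (R : cubiculated_region K N) (S : topologicalType)
    (psi : embedded_discrete_surface R S) (a b : {set edge_type R})
    (u H : cell R 1 -> int) (n : int) (W : edge_type R -> int)
    (e0 : cell R 1) :
  (forall p, tiling_diff a b p = chain_boundary psi u p) ->
  (forall p, n * (p \in a)%:R - W p = chain_boundary psi H p) ->
  (forall e p, ds_square psi e ->
    p \in (up_edges (ds_walk psi e) :|: down_edges (ds_walk psi e))%SET ->
    0 < W p < n) ->
  ds_square psi e0 -> 0 < u e0 ->
  exists e, [/\ ds_square psi e, 0 < u e,
    forall p, p \in up_edges (ds_walk psi e) -> p \in a &
    forall p, p \in down_edges (ds_walk psi e) -> p \notin a].
Proof.
move=> ab aH Wn sq_e0 ue0.
have Pe0 : `[< ds_square psi e0 >] && (0 < u e0) by rewrite ue0 andbT; exact/asboolP.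
case: (@arg_maxP _ _ _ e0 (fun e => `[< ds_square psi e >] && (0 < u e)) H Pe0).
move=> e /andP[/asboolP sq_e ue] max_e; exists e; split=> //.
  move=> p pe; apply/negPn/negP => /negPf pa.
  have Wp : 0 < W p < n by apply: (Wn e) => //; rewrite inE pe.
  (* If no square lies across [p], then [u e <= 0], a contradiction. Otherwise
     [H e' = H e + W p > H e] and [u e' >= u e > 0], against maximality. *)
  have := ab p; have := aH p; rewrite /tiling_diff pa.
  case: (chain_boundary_up sq_e pe) => [bd|[e' sq_e' bd]]; rewrite !bd.
    by case: (p \in b) => /=; lia.
  move=> He bu; have : H e' <= H e; last by lia.
  apply: max_e; apply/andP; split; first exact/asboolP.
  by case: (p \in b) bu => /=; lia.
move=> p pe; apply/negP => pa.
have Wp : 0 < W p < n by apply: (Wn e) => //; rewrite inE pe orbT.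
(* The same with signs reversed: here [H e' - H e = n - W p > 0], which uses the upper bound on
   [W]. *)
have := ab p; have := aH p; rewrite /tiling_diff pa.
case: (chain_boundary_down sq_e pe) => [bd|[e' sq_e' bd]]; rewrite !bd.
  by case: (p \in b) => /=; lia.
move=> He bu; have : H e' <= H e; last by lia.
apply: max_e; apply/andP; split; first exact/asboolP.
by case: (p \in b) bu => /=; lia.
Qed.

(** * Flips, on tilings and on chains *)

(** The removed pair and the added pair each cover every corner exactly once, and the edges at other
    vertices stay. *)
Lemma perfect_matching_flip (T : finType) (V : T -> Prop) (E : T * T -> Prop)
    (t : {set T * T}) (c0 c1 c2 c3 : T) :
  uniq [:: c0; c1; c2; c3] -> V c0 -> V c1 -> V c2 -> V c3 ->
  E (c2, c1) -> E (c0, c3) -> (c0, c1) \in t -> (c2, c3) \in t ->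
  perfect_matching V E t ->
  perfect_matching V E
    ((t :\: [set (c0, c1); (c2, c3)]) :|: [set (c2, c1); (c0, c3)])%SET.
Proof.
move=> u4 V0 V1 V2 V3 E21 E03 t01 t23 [tE tV].
have [n01 [n02 [n03 [n12 [n13 n23]]]]] : c0 <> c1 /\ c0 <> c2 /\ c0 <> c3 /\
    c1 <> c2 /\ c1 <> c3 /\ c2 <> c3.
  move: u4; rewrite /= !inE !negb_or.
  move=> /andP[/and3P[/eqP ? /eqP ? /eqP ?] /andP[/andP[/eqP ? /eqP ?]]].
  by move=> /andP[/eqP ? _].
have at_unique c p q : V c -> p \in t -> q \in t -> (p.1 = c \/ p.2 = c) ->
    (q.1 = c \/ q.2 = c) -> p = q.
  move=> Vc pt qt pc qc; have [r [_ ru]] := tV c Vc.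
  by rewrite -(ru p) // -(ru q).
split=> [p|c Vc].
  by rewrite !inE => /orP[/andP[_ /tE]//|/orP[]/eqP->].
have old p : p \in t -> p.1 <> c0 -> p.1 <> c2 ->
    p \in ((t :\: [set (c0, c1); (c2, c3)]) :|: [set (c2, c1); (c0, c3)])%SET.
  case: p => x y pt /= x0 x2; rewrite !inE pt !xpair_eqE.
  by move/eqP/negPf: x0 => ->; move/eqP/negPf: x2 => ->.
have new p : p \in ((t :\: [set (c0, c1); (c2, c3)]) :|:
      [set (c2, c1); (c0, c3)])%SET ->
    [\/ [/\ p \in t, p <> (c0, c1) & p <> (c2, c3)], p = (c2, c1)
      | p = (c0, c3)].
  rewrite !inE negb_or => /orP[/andP[/andP[/eqP ? /eqP ?] ?]|/orP[]/eqP ?].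
  - by apply: Or31.
  - exact: Or32.
  - exact: Or33.
(* With [q] a removed edge at the corner [c']: no surviving edge of [t] touches [c'], which [t]
   covers only by [q]. *)
have fresh p c' q : V c' -> q \in t -> q.1 = c' \/ q.2 = c' ->
    p \in t -> p <> q -> p.1 = c' \/ p.2 = c' -> False.
  by move=> Vc' qt qc pt pq pc; apply: pq; apply: (at_unique c').
have [c0E|nc0] := eqVneq c c0.
  exists (c0, c3); split; first by rewrite !inE eqxx !orbT c0E; split=> //; left.
  move=> p [/new[[pt p01 p23]|->|//]] /= pc.
    by case: (fresh p c (c0, c1)) => //; left.
  by case: pc => pc; [case: n02|case: n01]; rewrite -c0E pc.
have [c1E|nc1] := eqVneq c c1.
  exists (c2, c1); split; first by rewrite !inE eqxx !orbT c1E; split=> //; right.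
  move=> p [/new[[pt p01 p23]|//|->]] /= pc.
    by case: (fresh p c (c0, c1)) => //; right.
  by case: pc => pc; [case: n01|case: n13]; rewrite -c1E pc.
have [c2E|nc2] := eqVneq c c2.
  exists (c2, c1); split; first by rewrite !inE eqxx !orbT c2E; split=> //; left.
  move=> p [/new[[pt p01 p23]|//|->]] /= pc.
    by case: (fresh p c (c2, c3)) => //; left.
  by case: pc => pc; [case: n02|case: n23]; rewrite -c2E pc.
have [c3E|nc3] := eqVneq c c3.
  exists (c0, c3); split; first by rewrite !inE eqxx !orbT c3E; split=> //; right.
  move=> p [/new[[pt p01 p23]|->|//]] /= pc.
    by case: (fresh p c (c2, c3)) => //; right.
  by case: pc => pc; [case: n23|case: n13]; rewrite -c3E pc.
have away x y : x != c -> y != c -> ~ (x = c \/ y = c).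
  by move=> /eqP xc /eqP yc [].
have [p [[pt pc] pu]] := tV c Vc; exists p; split.
  split=> //; rewrite !inE pt andbT negb_or.
  by case: (p =P (c0, c1)) => [pE|_]; [|case: (p =P (c2, c3)) => [pE|_//]];
    rewrite pE /= in pc; case: (away _ _ _ _ pc); rewrite eq_sym.
move=> q [/new[[qt _ _]|->|->]] /= qc; first exact: pu.
  by case: (away c2 c1); rewrite // eq_sym.
by case: (away c0 c3); rewrite // eq_sym.
Qed.

(** A tiling through the second edge at the white end of [p] must omit [p]; this will yield the
    strict upper bound on the edge counts. *)
Lemma square_edge_sibling (K : realType) (N : nat) (R : cubiculated_region K N)
    (S : topologicalType) (psi : embedded_discrete_surface R S)
    (e : cell R 1) (p : edge_type R) :
  ds_square psi e ->
  p \in (up_edges (ds_walk psi e) :|: down_edges (ds_walk psi e))%SET ->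
  exists q, [/\ q \in (up_edges (ds_walk psi e) :|: down_edges (ds_walk psi e))%SET,
                q.1 = p.1 & q <> p].
Proof.
move=> sq_e; have [c0 [c1 [c2 [c3 [[u4 _ _] _ -> ->]]]]] := square_corners sq_e.
have n13 : c1 <> c3.
  by apply/eqP; move: u4; rewrite /= !inE !negb_or => /and3P[_ /andP[_ ->]].
have n31 := nesym n13.
by rewrite !inE -!orbA => /or4P[] /eqP->; [exists (c0, c3)|exists (c2, c1)|
  exists (c2, c3)|exists (c0, c1)]; split=> //;
  rewrite ?inE ?eqxx ?orbT // => -[].
Qed.

(** Exchanging the up pair, contained in [a], for the down pair, disjoint from [a], subtracts
    exactly the boundary of the square. The reverse flip serves when the descent moves the far end
    of the path. *)
Lemma flip_square (K : realType) (N : nat) (R : cubiculated_region K N)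
    (S : topologicalType) (psi : embedded_discrete_surface R S)
    (a : {set edge_type R}) (e : cell R 1) :
  surface_tiling psi a -> ds_square psi e ->
  (forall p, p \in up_edges (ds_walk psi e) -> p \in a) ->
  (forall p, p \in down_edges (ds_walk psi e) -> p \notin a) ->
  exists a' : {set edge_type R},
    [/\ surface_tiling psi a', flip psi a a', flip psi a' a &
        forall p, (p \in a')%:R =
          (p \in a)%:R - chain_boundary psi (fun x => (x == e)%:R) p].
Proof.
move=> ta sq_e up_a down_a.
have [c0 [c1 [c2 [c3 [sw /and4P[w0 b1 w2 b3] upE downE]]]]] := square_corners sq_e.
have [u4 w4 _] := sw.
have surf := square_edges_surface sq_e.
have vtx c : c \in [:: c0; c1; c2; c3] -> surface_vertex psi c.
  by move=> /w4; exact: square_vertex.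
rewrite upE downE in up_a down_a surf.
have up01 : (c0, c1) \in a by apply: up_a; rewrite !inE eqxx.
have up23 : (c2, c3) \in a by apply: up_a; rewrite !inE eqxx orbT.
have dn21 : (c2, c1) \notin a by apply: down_a; rewrite !inE eqxx.
have dn03 : (c0, c3) \notin a by apply: down_a; rewrite !inE eqxx orbT.
exists ((a :\: [set (c0, c1); (c2, c3)]) :|: [set (c2, c1); (c0, c3)])%SET.
have ud p : p \in [set (c0, c1); (c2, c3)]%SET ->
    p \notin [set (c2, c1); (c0, c3)]%SET.
  by move=> /up_a pa; apply/negP => /down_a; rewrite pa.
split.
- by apply: perfect_matching_flip => //;
    try (by apply: vtx; rewrite !inE eqxx ?orbT);
    apply: (proj1 (surf _ _)); rewrite !inE eqxx ?orbT.
- exists e, c0, c1, c2, c3; rewrite /mk_edge (negPf w0) b1 (negPf w2) b3.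
  by split.
(* The same square read from its next corner, so that the removed and the added pair change
   roles. *)
- exists e, c1, c2, c3, c0; rewrite /mk_edge (negPf w0) b1 (negPf w2) b3.
  split=> //; first exact: (square_walk_rot 1 sw).
  + by rewrite !inE eqxx !orbT.
  + by rewrite !inE eqxx !orbT.
  rewrite [[set (c2, c3); _]%SET]finset.setUC; apply/setP => p.
  move: (up_a p) (down_a p) (ud p).
  move: [set (c0, c1); _]%SET [set (c2, c1); _]%SET => A B.
  rewrite !finset.in_setU !finset.in_setD !finset.in_setU finset.in_setD.
  by case: (p \in A); case: (p \in B); case: (p \in a) => //= h1 h2 h3;
    (have := h1 isT) || (have := h2 isT) || (have := h3 isT).
move=> p; rewrite chain_boundary_delta // upE downE.
move: (up_a p) (down_a p) (ud p).
move: [set (c0, c1); _]%SET [set (c2, c1); _]%SET => A B.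
rewrite finset.in_setU finset.in_setD.
by case: (p \in A); case: (p \in B); case: (p \in a) => //= h1 h2 h3;
  (have := h1 isT) || (have := h2 isT) || (have := h3 isT).
Qed.

(** * Descent on the 2-chain between two tilings *)

(** Induction on a bound for the sum of [|u e|] over the squares, which every flip lowers by one. As
    [n] and [W] are fixed, the height of a flipped tiling is obtained by correcting [H] at a single
    square. *)
Lemma flip_connected_of_heights (K : realType) (N : nat)
    (R : cubiculated_region K N) (S : topologicalType)
    (psi : embedded_discrete_surface R S) (n : int) (W : edge_type R -> int) :
  (forall e p, ds_square psi e ->
    p \in (up_edges (ds_walk psi e) :|: down_edges (ds_walk psi e))%SET ->
    0 < W p < n) ->
  forall (m : nat) (a b : {set edge_type R}) (u H : cell R 1 -> int),
  (\sum_(e | `[< ds_square psi e >]) `|u e|%N <= m)%N ->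
  surface_tiling psi a -> surface_tiling psi b ->
  (forall p, tiling_diff a b p = chain_boundary psi u p) ->
  (forall p, n * (p \in a)%:R - W p = chain_boundary psi H p) ->
  flip_connected psi a b.
Proof.
move=> Wn; elim=> [|m IHm] a b u H um ta tb ab aH.
  suff -> : a = b by exact: rt_refl.
  apply/setP => p; have := ab p; rewrite /chain_boundary big1 => [|e sq_e].
    by rewrite /tiling_diff; case: (p \in a); case: (p \in b).
  move: um; rewrite leqn0 sum_nat_eq0 => /forallP/(_ e); rewrite sq_e absz_eq0.
  by move=> /eqP->; rewrite mul0r.
have decrease e (v : cell R 1 -> int) : ds_square psi e ->
    `|v e|%N = `|u e|.-1%N -> (0 < `|u e|)%N -> (forall x, x != e -> v x = u x) ->
    (\sum_(e | `[< ds_square psi e >]) `|v e|%N <= m)%N.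
  move=> /asboolP sq_e ve ue vu; rewrite -ltnS; apply: leq_trans um.
  rewrite (bigD1 e) //= [X in (_ < X)%N](bigD1 e) //= ve -addSn prednK //.
  by apply: eq_leq; congr addn; apply: eq_bigr => x /andP[_ /vu->].
case: (pickP (fun e => `[< ds_square psi e >] && (0 < u e))) => [e0|no_pos].
  move=> /andP[/asboolP sq_e0 ue0].
  have [e [sq_e ue up_a down_a]] := exists_descending_square ab aH Wn sq_e0 ue0.
  have [a' [ta' aa' _ a'E]] := flip_square ta sq_e up_a down_a.
  apply: rt_trans; first exact: rt_step aa'.
  (* The flip subtracts the boundary of [e] from [a], hence 1 from [u e] and [n] from [H e]. *)
  apply: (IHm a' b (fun x => u x - 1 * (x == e)%:R) (fun x => H x - n * (x == e)%:R)) => //.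
  - apply: (decrease e) => //; rewrite ?eqxx; lia.
  - by move=> p; rewrite chain_boundary_subZ -ab /tiling_diff a'E; ring.
  - by move=> p; rewrite chain_boundary_subZ -aH a'E; ring.
case: (pickP (fun e => `[< ds_square psi e >] && (u e < 0))) => [e0|no_neg].
  move=> /andP[/asboolP sq_e0 ue0].
  (* With [u] nowhere positive, the roles are exchanged: [- u] bounds [b - a], and [H - n u] is the
     height of [b]. The form [0 - 1 * u x] fits [chain_boundary_subZ]. *)
  have ba p : tiling_diff b a p = chain_boundary psi (fun x => 0 - 1 * u x) p.
    rewrite chain_boundary_subZ -ab /tiling_diff.
    have -> : chain_boundary psi (fun=> 0) p = 0.
      by apply: big1 => e _; rewrite mul0r.
    lia.
  have bH p : n * (p \in b)%:R - W p = chain_boundary psi (fun x => H x - n * u x) p.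
    by rewrite chain_boundary_subZ -aH -ab /tiling_diff; ring.
  have nue0 : 0 < 0 - 1 * u e0 by lia.
  have [e [sq_e ue up_b down_b]] := exists_descending_square ba bH Wn sq_e0 nue0.
  have [b' [tb' _ b'b b'E]] := flip_square tb sq_e up_b down_b.
  apply: rt_trans; last exact: rt_step b'b.
  (* The flip of [b] adds 1 to the negative value [u e]; the height [H] of [a] is unchanged. *)
  apply: (IHm a b' (fun x => u x - -1 * (x == e)%:R) H) => //.
  - apply: (decrease e) => //; rewrite ?eqxx; lia.
  - by move=> p; rewrite chain_boundary_subZ -ab /tiling_diff b'E; ring.
suff u0 : forall e, ds_square psi e -> u e = 0.
  apply: (IHm a b u H) => //; rewrite big1 // => e /asboolP sq_e.
  by rewrite u0.
move=> e /asboolP sq_e; have := no_pos e; have := no_neg e.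
by rewrite sq_e /=; case: (ltgtP (u e) 0).
Qed.

(** * Equal flux, and averaging over a flux class *)

(** The cycle [t - tb] lies in its own coset, hence in that of [t' - tb]. *)
Lemma Flux_eqP (K : realType) (N : nat) (R : cubiculated_region K N)
    (S : topologicalType) (psi : embedded_discrete_surface R S)
    (tb t t' : {set edge_type R}) :
  Flux psi tb t = Flux psi tb t' ->
  exists u, forall p, tiling_diff t t' p = chain_boundary psi u p.
Proof.
move=> tt'; have : Flux psi tb t (tiling_diff t tb).
  exists (fun=> 0) => p; rewrite /chain_boundary big1 ?addr0 // => e _.
  by rewrite mul0r.
by rewrite tt' => -[u uE]; exists u => p; have := uE p; rewrite /tiling_diff; lia.
Qed.

Lemma sum_indicator_gt0 (I : finType) (A : {set I}) (B : pred I) (i : I) :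
  i \in A -> B i -> 0 < \sum_(j in A) (B j)%:R :> int.
Proof.
move=> iA Bi; rewrite (bigD1 i) //= Bi ltr_pwDl //.
by apply: sumr_ge0 => j _; rewrite ler0n.
Qed.

Theorem theorem8p1 (K : realType) (N : nat) (R : cubiculated_region K N)
    (S : topologicalType) (psi : embedded_discrete_surface R S)
    (Seifert_psi : is_discrete_Seifert_surface psi)
    (bdS_nonempty : @surface_boundary K S !=set0)
    (tb t0 t1 : {set edge_type R})
    (tiling_tb : surface_tiling psi tb)
    (tiling_t0 : surface_tiling psi t0) (tiling_t1 : surface_tiling psi t1)
    (stable_t0 : stable psi tb t0) (stable_t1 : stable psi tb t1)
    (same_flux : Flux psi tb t0 = Flux psi tb t1) :
  flip_connected psi t0 t1.
Proof.
pose T := [set t : {set edge_type R} |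
  `[< surface_tiling psi t /\ Flux psi tb t0 = Flux psi tb t >]]%SET.
have T_diff t : exists u, t \in T ->
    forall p, tiling_diff t0 t p = chain_boundary psi u p.
  (* Outside [T] the chain takes the default value 0; only members of [T] enter the sums below. *)
  have [tT|] := boolP (t \in T); last by exists (fun=> 0).
  by move: tT; rewrite inE => /asboolP[_ /Flux_eqP[u uE]]; exists u.
have [U UE] := choice T_diff.
have [u uE] := Flux_eqP same_flux.
have T_edge p : surface_edge psi p -> exists2 t, t \in T & p \in t.
  move=> /stable_t0[t [tiling_t fl pt]]; exists t => //.
  by rewrite inE; apply/asboolP.
(* The number of tilings in [T] is written as a sum of ones, so that [n t0 - W] splits into the
   differences [t0 - t]. *)
apply: (@flip_connected_of_heights _ _ _ _ psi (\sum_(t in T) 1)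
  (fun p => \sum_(t in T) (p \in t)%:R) _ _ t0 t1 u
  (fun e => \sum_(t in T) U t e) (leqnn _)) => //; last first.
  move=> p; rewrite chain_boundary_sum mulr_suml -sumrB; apply: eq_bigr => t tT.
  by rewrite mul1r -UE.
move=> e p sq_e pe; have [p_edge p_vtx] := square_edges_surface sq_e pe.
(* Stability at [p] gives a tiling in [T] through [p], so the count is positive. *)
have [t tT pt] := T_edge _ p_edge.
rewrite (sum_indicator_gt0 (B := fun t : {set _} => p \in t) tT) //=.
(* Stability at the sibling [q] gives a tiling in [T] that covers the common white vertex by [q] and
   so omits [p]; the count is below [n]. *)
have [q [qe qp1 qp]] := square_edge_sibling sq_e pe.
have [q_edge _] := square_edges_surface sq_e qe.
have [t' t'T qt'] := T_edge _ q_edge.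
have pt' : p \notin t'.
  apply/negP => pt'; move: (t'T); rewrite inE => /asboolP[[_ /(_ _ p_vtx)] + _].
  move=> [r [_ ru]]; apply: qp; rewrite -(ru p) ?(ru q) //; split=> //.
    by left.
  by left.
rewrite -subr_gt0 -sumrB.
rewrite (eq_bigr (fun t : {set _} => (p \notin t)%:R)) => [|x _].
  exact: (sum_indicator_gt0 (B := fun t : {set _} => p \notin t) t'T).
by case: (p \in x).
Qed.
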